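(* Let $M^*$ be the true MDP, let $\mathcal D$ be a random dataset collected in $M^*$, let $\delta_{\mathbb I}\in[0,1]$ and let $\hat M_{\mathbb I}$ be the interval MDP estimated from $\mathcal D$, with $\Pr(M^*\in\hat M_{\mathbb I})\ge 1-\delta_{\mathbb I}$. Let $\theta\in[0,1]$ be a feasible threshold, let $\pi^b$ be a baseline policy and $N_\wedge\in\mathbb N$. Let $\pi^\iota_{\mathrm{sh}}$ be the policy computed from $\mathcal D$ by shielded SPIBB. Then $\pi^\iota_{\mathrm{sh}}$ is $\theta$-safe in the true MDP $M^*$ with probability at least $1-\delta_{\mathbb I}$: $$\Pr\Big(\forall s\in S,\ \forall a\in\mathrm{supp}(\pi^\iota_{\mathrm{sh}}(\cdot\mid s)):\ \mathbb Q^*_{M^*}(s,a)\ge 1-\theta\Big)\ \ge\ 1-\delta_{\mathbb I}.$$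
   Context: MDP: a tuple $M=(S,s_0,A,T,R,\gamma)$ with finite state set $S$, initial state $s_0\in S$, finite action set $A$, nonempty sets $A(s)\subseteq A$ of actions available at $s$, a transition function assigning to each $s\in S$, $a\in A(s)$ a probability distribution $T(\cdot\mid s,a)$ on $S$, bounded reward $R:S\times A\to\mathbb R$, and $\gamma\in[0,1)$. A (stochastic memoryless) policy is $\pi:S\to\Delta(A)$ choosing available actions; $\Pi$ is the set of policies. Interval MDP (IMDP): like an MDP, but the transition function $T_{\mathbb I}$ assigns to each $(s,a,s')$, $a\in A(s)$, either the value $0$ or an interval $[l,u]$ with $0<l<u\le 1$. An MDP $M$ with the same $S,s_0,A,A(\cdot),R,\gamma$ and transition function $T$ belongs to the IMDP $M_{\mathbb I}$, written $M\in M_{\mathbb I}$, if for all $s$, $a\in A(s)$, $s'$: $T(s'\mid s,a)\in T_{\mathbb I}(s'\mid s,a)$ when that is an interval, and $T(s'\mid s,a)=0$ when it is $0$. The IMDP $\hat M_{\mathbb I}$ (with interval transition function $\hat T_{\mathbb I}$) is a function of the random dataset $\mathcal D$; all probabilities $\Pr$ are over $\mathcal D$. $\hat M_{\mathbb I}$ has the same $S,s_0,A,A(\cdot),R,\gamma$ as $M^*$ and is constructed so that $\Pr(M^*\in\hat M_{\mathbb I})\ge 1-\delta_{\mathbb I}$. Reach-avoid: fixed disjoint sets $S_T\subset S$ (target) and $S_U\subset S$ (unsafe). For an MDP $M$, $\pi\in\Pi$, $s\in S$, $\mathbb P_M^{\pi,\varphi}(s)$ is the probability, starting in $s$ and following $\pi$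 in $M$, that a state of $S_T$ is reached without visiting $S_U$ before (so it is $1$ for $s\in S_T$ and $0$ for $s\in S_U$). Define $\mathbb V^*_M(s)=\max_{\pi\in\Pi}\mathbb P_M^{\pi,\varphi}(s)$ and $\mathbb Q^*_M(s,a)=\sum_{s'}T(s'\mid s,a)\mathbb V_M^*(s')$ for $a\in A(s)$; and $\mathbb V^*_{\hat M_{\mathbb I}}(s)=\max_{\pi\in\Pi}\min_{M\in\hat M_{\mathbb I}}\mathbb P_M^{\pi,\varphi}(s)$ and $\mathbb Q^*_{\hat M_{\mathbb I}}(s,a)=\inf_{\underline T(\cdot\mid s,a)\in \hat T_{\mathbb I}(s,a)\cap\Delta(S)}\sum_{s'}\underline T(s'\mid s,a)\mathbb V^*_{\hat M_{\mathbb I}}(s')$ for $a\in A(s)$, where $\hat T_{\mathbb I}(s,a)\cap\Delta(S)$ is the set of distributions on $S$ respecting the intervals (and zeros) of $\hat T_{\mathbb I}$ at $(s,a)$. $\theta$-shield: $A_{\mathrm{sh}}(s)=\{a\in A(s)\mid \mathbb Q^*_{\hat M_{\mathbb I}}(s,a)>1-\theta\}$; $\theta$ is feasible if $A_{\mathrm{sh}}(s)\neq\emptyset$ for all $s$. Shielded baseline: $\pi^b_{\mathrm{sh}}(a\mid s)=\pi^b(a\mid s)+\frac{1}{|A_{\mathrm{sh}}(s)|}\sum_{a'\in A\setminus A_{\mathrm{sh}}(s)}\pi^b(a'\mid s)$ if $a\in A_{\mathrm{sh}}(s)$, and $0$ otherwise. Shielded SPIBB: let $N_{\mathcal D}(s,a)$,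 $N_{\mathcal D}(s,a,s')$ be the counts of $(s,a)$ and $(s,a,s')$ in $\mathcal D$. The maximum-likelihood MDP $\hat M$ has transition function $\hat T(s'\mid s,a)=N_{\mathcal D}(s,a,s')/N_{\mathcal D}(s,a)$ if $N_{\mathcal D}(s,a)>0$ and $0$ otherwise; the shielded version $\hat M_{\mathrm{sh}}$ is $\hat M$ with only actions in $A_{\mathrm{sh}}(s)$ available at each $s$. $Q^\pi_{\hat M_{\mathrm{sh}}}$ is the discounted action-value function of $\pi$ in $\hat M_{\mathrm{sh}}$. Bootstrapped set: $\mathcal B_{\mathrm{sh}}=\{(s,a)\in S\times A: N_{\mathcal D}(s,a)\le N_\wedge\ \text{or}\ a\notin A_{\mathrm{sh}}(s)\}$; $A_{\not\mathcal B}(s)=\{a\in A:(s,a)\notin\mathcal B_{\mathrm{sh}}\}$. Starting from $\pi=\pi^b_{\mathrm{sh}}$, iterate $\pi\leftarrow\pi'$ until $\pi'=\pi$, where $\pi'(a\mid s)=\pi^b_{\mathrm{sh}}(a\mid s)$ if $(s,a)\in\mathcal B_{\mathrm{sh}}$; $\pi'(a\mid s)=\sum_{a'\in A_{\not\mathcal B}(s)}\pi^b_{\mathrm{sh}}(a'\mid s)$ if $a$ is the (tie-broken) maximizer of $Q^\pi_{\hat M_{\mathrm{sh}}}(s,\cdot)$ over $A_{\not\mathcal B}(s)$; and $\pi'(a\mid s)=0$ otherwise. The resulting policy is $\pi^\iota_{\mathrm{sh}}$. *)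

(* Defs.v *)
From mathcomp Require Import all_boot all_order all_algebra.
From mathcomp Require Import all_classical all_reals all_analysis.

Set Implicit Arguments.
Unset Strict Implicit.
Unset Printing Implicit Defensive.

Import Order.TTheory GRing.Theory Num.Theory.
Import numFieldNormedType.Exports.

Local Open Scope classical_set_scope.
Local Open Scope ring_scope.

(* Everything an MDP and an interval MDP share besides the transitions; the
   state and action sets are the finite types [S] and [A]. *)
Record frame (R : realType) (S A : finType) := Frame {
  init : S ;
  avail : S -> {set A} ;
  reward : S -> A -> R ;
  discount : R }.

(* Boundedness of the reward is automatic since [S] and [A] are finite. *)
Definition is_frame (R : realType) (S A : finType) (F : frame R S A) : Prop :=
  (forall s, avail F s != finset.set0) /\ 0 <= discount F < 1.

(* A frame with an arbitrary transition table: [is_mdp] below cuts out the MDPs,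
   while the maximum-likelihood model, which has all-zero rows at unvisited
   pairs, is only a [model]. *)
Record model (R : realType) (S A : finType) := Model {
  model_frame :> frame R S A ;
  trans : S -> A -> S -> R }.

Definition is_dist (R : realType) (T : finType) (p : T -> R) : Prop :=
  (forall x, 0 <= p x) /\ \sum_x p x = 1.

(* Rows of [trans] at unavailable actions are meaningless and unconstrained. *)
Definition is_mdp (R : realType) (S A : finType) (M : model R S A) : Prop :=
  is_frame M /\ forall s a, a \in avail M s -> is_dist (trans M s a).

Definition is_policy (R : realType) (S A : finType) (F : frame R S A)
    (pi : S -> A -> R) : Prop :=
  forall s, is_dist (pi s) /\ forall a, a \notin avail F s -> pi s a = 0.

(* [itrans s a s' = None] is the value 0, [Some (l, u)] is the interval [l, u]. *)
Record imodel (R : realType) (S A : finType) := IModel {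
  imodel_frame :> frame R S A ;
  itrans : S -> A -> S -> option (R * R) }.

Definition is_imdp (R : realType) (S A : finType) (MI : imodel R S A) : Prop :=
  is_frame MI /\
  forall s a s' l u, a \in avail MI s -> itrans MI s a s' = Some (l, u) ->
    0 < l /\ l < u /\ u <= 1.

Definition in_itrans (R : realType) (t : option (R * R)) (x : R) : Prop :=
  if t is Some (l, u) then l <= x <= u else x = 0.

Definition in_imdp (R : realType) (S A : finType) (M : model R S A)
    (MI : imodel R S A) : Prop :=
  [/\ is_mdp M, model_frame M = imodel_frame MI &
      forall s a s', a \in avail MI s ->
        in_itrans (itrans MI s a s') (trans M s a s')].

Definition chain_step (R : realType) (S A : finType) (M : model R S A)
    (pi : S -> A -> R) (s s' : S) : R :=
  \sum_a pi s a * trans M s a s'.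

(* Probability of the cylinder of the runs that start with [s :: p]. *)
Fixpoint path_prob (R : realType) (S A : finType) (M : model R S A)
    (pi : S -> A -> R) (s : S) (p : seq S) : R :=
  if p is s' :: p' then chain_step M pi s s' * path_prob M pi s' p' else 1.

Definition first_hit (S : finType) (ST SU : {set S}) (s : S) (p : seq S) : bool :=
  (last s p \in ST) && all (fun x => x \notin ST :|: SU) (belast s p).

(* The event "[ST] is reached without visiting [SU] before" is the disjoint union,
   over the paths that end with their first visit to [ST] and avoid [SU], of the
   corresponding cylinders; its probability is the sum of theirs.
   See [reach_avoid_probP]. *)
Definition reach_avoid_prob (R : realType) (S A : finType) (ST SU : {set S})
    (M : model R S A) (pi : S -> A -> R) (s : S) : R :=
  fine (\sum_(0 <= n <oo)
    (\sum_(p : n.-tuple S | first_hit ST SU s p) path_prob M pi s p)%:E)%E.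

(* The optima over policies, MDPs and distributions are rendered by
   [sup] and [inf], which are 0 on the empty set. *)
Definition Vopt (R : realType) (S A : finType) (ST SU : {set S})
    (M : model R S A) (s : S) : R :=
  sup [set reach_avoid_prob ST SU M pi s | pi in is_policy M].

Definition Qopt (R : realType) (S A : finType) (ST SU : {set S})
    (M : model R S A) (s : S) (a : A) : R :=
  \sum_s' trans M s a s' * Vopt ST SU M s'.

Definition Vrob (R : realType) (S A : finType) (ST SU : {set S})
    (MI : imodel R S A) (s : S) : R :=
  sup [set inf [set reach_avoid_prob ST SU M pi s | M in [set M | in_imdp M MI]]
      | pi in is_policy MI].

Definition Qrob (R : realType) (S A : finType) (ST SU : {set S})
    (MI : imodel R S A) (s : S) (a : A) : R :=
  inf [set \sum_s' t s' * Vrob ST SU MI s'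
      | t in [set t : S -> R | is_dist t /\
                 forall s', in_itrans (itrans MI s a s') (t s')]].

Definition shield (R : realType) (S A : finType) (ST SU : {set S})
    (MI : imodel R S A) (theta : R) (s : S) : {set A} :=
  [set a in avail MI s | 1 - theta < Qrob ST SU MI s a]%SET.

Definition feasible (R : realType) (S A : finType) (ST SU : {set S})
    (MI : imodel R S A) (theta : R) : Prop :=
  forall s, shield ST SU MI theta s != finset.set0.

Definition shielded (R : realType) (S A : finType) (Ash : S -> {set A})
    (pib : S -> A -> R) (s : S) (a : A) : R :=
  if a \in Ash s
  then pib s a + #|Ash s|%:R^-1 * \sum_(a' | a' \notin Ash s) pib s a'
  else 0.

(* The recorded transitions (state, action, successor), in order of collection. *)
Definition dataset (S A : finType) : Type := seq (S * A * S).

Definition count_sa (S A : finType) (D : dataset S A) (s : S) (a : A) : nat :=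
  count (fun x => x.1 == (s, a)) D.

Definition count_sas (S A : finType) (D : dataset S A) (s : S) (a : A) (s' : S)
  : nat := count_mem (s, a, s') D.

(* The frame [F] is that of the true MDP.  Division by 0 is 0 here, but the
   case distinction is kept explicit. *)
Definition ml_model (R : realType) (S A : finType) (F : frame R S A)
    (D : dataset S A) : model R S A :=
  Model F (fun s a s' =>
    if (0 < count_sa D s a)%N
    then (count_sas D s a s')%:R / (count_sa D s a)%:R else 0).

Definition restrict_actions (R : realType) (S A : finType) (M : model R S A)
    (Ash : S -> {set A}) : model R S A :=
  Model (Frame (init M) Ash (reward M) (discount M)) (trans M).

(* Law of the t-th state-action pair from (s0, a0), following [pi] afterwards.
   When [trans] has a zero row, the process stops there. *)
Fixpoint sa_law (R : realType) (S A : finType) (M : model R S A)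
    (pi : S -> A -> R) (s0 : S) (a0 : A) (t : nat) (s : S) (a : A) : R :=
  if t is t'.+1 then
    (\sum_x \sum_b sa_law M pi s0 a0 t' x b * trans M x b s) * pi s a
  else ((s, a) == (s0, a0))%:R.

Definition Qpol (R : realType) (S A : finType) (M : model R S A)
    (pi : S -> A -> R) (s : S) (a : A) : R :=
  limn (series (fun t => discount M ^+ t *
    \sum_x \sum_b sa_law M pi s a t x b * reward M x b)).

Definition bootstrapped (S A : finType) (Ash : S -> {set A}) (D : dataset S A)
    (Nw : nat) (s : S) (a : A) : bool :=
  (count_sa D s a <= Nw)%N || (a \notin Ash s).

Definition nonboot (S A : finType) (Ash : S -> {set A}) (D : dataset S A)
    (Nw : nat) (s : S) : {set A} :=
  [set a | ~~ bootstrapped Ash D Nw s a]%SET.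

Definition argmaxs (R : realType) (A : finType) (q : A -> R) (B : {set A})
  : {set A} := [set a in B | [forall b in B, q b <= q a]]%SET.

(* A fixed rule breaking ties in each state: it picks an element of every
   nonempty set of candidate maximizers. *)
Definition tie_break (S A : finType) (tb : S -> {set A} -> A) : Prop :=
  forall s B, B != finset.set0 -> tb s B \in B.

Definition spibb_step (R : realType) (S A : finType) (F : frame R S A)
    (tb : S -> {set A} -> A) (Ash : S -> {set A}) (D : dataset S A) (Nw : nat)
    (pib : S -> A -> R) (pi : S -> A -> R) : S -> A -> R :=
  fun s a =>
    let q := Qpol (restrict_actions (ml_model F D) Ash) pi s in
    let B := nonboot Ash D Nw s in
    if bootstrapped Ash D Nw s a then shielded Ash pib s a
    else if a == tb s (argmaxs q B) then \sum_(a' in B) shielded Ash pib s a'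
    else 0.

Definition spibb_iter (R : realType) (S A : finType) (F : frame R S A)
    (tb : S -> {set A} -> A) (Ash : S -> {set A}) (D : dataset S A) (Nw : nat)
    (pib : S -> A -> R) (n : nat) : S -> A -> R :=
  iter n (spibb_step F tb Ash D Nw pib) (shielded Ash pib).

(* The iterate at which the loop stops.  All stopping indices give the same
   policy; [xget]'s default index 0 is only used if the loop does not stop. *)
Definition spibb (R : realType) (S A : finType) (F : frame R S A)
    (tb : S -> {set A} -> A) (Ash : S -> {set A}) (D : dataset S A) (Nw : nat)
    (pib : S -> A -> R) : S -> A -> R :=
  spibb_iter F tb Ash D Nw pib
    (xget 0%N [set n | spibb_iter F tb Ash D Nw pib n.+1 =
                       spibb_iter F tb Ash D Nw pib n]).

Definition supp (R : realType) (A : finType) (p : A -> R) : {set A} :=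
  [set a | 0 < p a]%SET.

(* [dataset] is countable: this is measurability for the discrete sigma-algebra. *)
Definition random_dataset (d : measure_display) (Om : measurableType d)
    (S A : finType) (D : Om -> dataset S A) : Prop :=
  forall x : dataset S A, measurable (D @^-1` [set x]).

(* [D] is collected in [M]: only available actions are recorded and, given the
   transitions [h] recorded before and the next recorded pair (s, a), the recorded
   successor has law [trans M s a].  How states and actions are chosen (behaviour
   policy, restarts, number of samples) is left free. *)
Definition collected_in (R : realType) (d : measure_display)
    (Om : measurableType d) (P : probability Om R) (S A : finType)
    (M : model R S A) (D : Om -> dataset S A) : Prop :=
  [/\ random_dataset D,
      {ae P, forall w, all (fun x => x.1.2 \in avail M x.1.1) (D w)} &
      forall (h : dataset S A) s a s', a \in avail M s ->
        P [set w | prefix (rcons h (s, a, s')) (D w)] =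
        ((trans M s a s')%:E *
         P [set w | [exists y, prefix (rcons h (s, a, y)) (D w)]])%E].

(* If X is a process started in s whose finite-dimensional distributions are those
   of the chain induced by [pi] in [M], then the probability of the reach-avoid
   event of X is [reach_avoid_prob]. *)
Lemma reach_avoid_probP (R : realType) (d : measure_display)
    (Om : measurableType d) (P : probability Om R) (S A : finType)
    (ST SU : {set S}) (M : model R S A) (pi : S -> A -> R) (s : S)
    (X : nat -> Om -> S) :
  (forall n x, measurable (X n @^-1` [set x])) ->
  (forall w, X 0%N w = s) ->
  (forall p : seq S, P [set w | [seq X i w | i <- iota 1 (size p)] = p] =
                     (path_prob M pi s p)%:E) ->
  P [set w | exists n, X n w \in ST /\ forall m, (m < n)%N -> X m w \notin SU] =
  (reach_avoid_prob ST SU M pi s)%:E.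
Proof.
move=> mX X0 Xp.
pose tr n w : seq S := [seq X i w | i <- iota 1 n].
have szt n w : size (tr n w) = n by rewrite size_map size_iota.
have lastt n w : last s (tr n w) = X n w.
  rewrite /tr; case: n => [|n]; first by rewrite /= X0.
  by rewrite -[n.+1]addn1 iotaD map_cat last_cat /= add1n addn1.
have belt n w : belast s (tr n w) = [seq X i w | i <- iota 0 n].
  rewrite /tr; elim: n => [//|n IH].
  rewrite -[n.+1]addn1 !iotaD !map_cat.
  by rewrite belast_cat IH -/(tr n w) lastt /= add0n.
pose cyl n (p : n.-tuple S) := [set w | tr n w = p].
pose E n := \bigcup_(p in [set p : n.-tuple S | first_hit ST SU s p]) cyl n p.
have EP n w : E n w <-> X n w \in ST /\
    forall m, (m < n)%N -> X m w \notin ST :|: SU.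
  have -> : E n w <-> first_hit ST SU s (tr n w).
    split=> [[p /= hp ->//]|h].
    have st : size (tr n w) == n by rewrite szt.
    by exists (Tuple st).
  rewrite /first_hit lastt belt all_map; split=> [/andP[-> /allP h]|[-> h]].
    by split=> // m mn; apply: h; rewrite mem_iota.
  by apply/allP => m; rewrite mem_iota => /h.
have mcyl n (p : n.-tuple S) : measurable (cyl n p).
  have mk k m (q : seq S) :
      measurable [set w | [seq X i w | i <- iota k m] = q].
    elim: m k q => [|m IH] k [|x q] /=.
    - by rewrite (_ : mkset _ = setT)//; apply/seteqP; split.
    - by rewrite (_ : mkset _ = set0)//; apply/seteqP; split.
    - by rewrite (_ : mkset _ = set0)//; apply/seteqP; split.
    rewrite (_ : mkset _ = (X k @^-1` [set x]) `&`
      [set w | [seq X i w | i <- iota k.+1 m] = q]).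
      by apply: measurableI => //; exact: IH.
    by apply/seteqP; split => w /= [-> ->].
  exact: mk.
have mE n : measurable (E n).
  by apply: fin_bigcup_measurable => // p _; exact: mcyl.
have tE : trivIset setT E.
  apply: ltn_trivIset => n m mn; rewrite -subset0 => w [/EP[h _] /EP[_ /(_ _ mn)]].
  by rewrite finset.inE h.
have PE n : P (E n) = (\sum_(p : n.-tuple S | first_hit ST SU s p)
     path_prob M pi s p)%:E.
  have fin : finite_set [set p : n.-tuple S | first_hit ST SU s p] by [].
  have tcyl : trivIset [set p : n.-tuple S | first_hit ST SU s p] (cyl n).
    by move=> p q _ _ [w [/= hp hq]]; apply: val_inj; rewrite /= -hp -hq.
  rewrite measure_fin_bigcup// -sumEFin
    -(bigfs _ (index_enum_uniq _)).
    by apply: eq_bigr => p _; rewrite -Xp size_tuple.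
  by move=> p _; rewrite mem_index_enum.
rewrite (_ : [set w | _] = \bigcup_n E n).
  have -> : reach_avoid_prob ST SU M pi s = fine (P (\bigcup_n E n)).
    congr fine; rewrite measure_bigcup//.
    rewrite [RHS](@eq_eseriesl _ _ xpredT); last by move=> n; rewrite in_setT.
    by apply: eq_eseriesr => n _; exact/esym/PE.
  by rewrite fineK// fin_num_measure//; exact: bigcup_measurable.
apply/seteqP; split => w /=.
  move=> [n [hn hm]].
  have ex : exists n, X n w \in ST by exists n.
  case: (ex_minnP ex) => m hm' mmin; exists m => //; apply/EP; split=> // k km.
  rewrite finset.inE negb_or; apply/andP; split.
    by apply/negP => /mmin; rewrite leqNgt km.
  by apply: hm; apply: leq_trans km (mmin _ hn).
move=> [n _ /EP[h1 h2]]; exists n; split=> // m /h2.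
by rewrite finset.inE negb_or => /andP[].
Qed.

(* Main.v *)
(* The policy computed by shielded SPIBB never leaves the shield: an unshielded
   action is bootstrapped, so every iterate gives it the shielded baseline
   probability 0.  On the event that the interval MDP contains the true one,
   the true MDP is one of the competitors in the minima defining the robust
   values, hence 1 - theta < Qrob <= Qopt on the shield. *)
Require Import Defs.
From mathcomp Require Import all_boot all_order all_algebra.
From mathcomp Require Import all_classical all_reals all_analysis.

Set Implicit Arguments.
Unset Strict Implicit.
Unset Printing Implicit Defensive.

Import Order.TTheory GRing.Theory Num.Theory.
Import numFieldNormedType.Exports.

Local Open Scope classical_set_scope.
Local Open Scope ring_scope.

Section ReachAvoid.
Context (R : realType) (S A : finType) (ST SU : {set S}) (M : model R S A).

(** The summand of the series in [reach_avoid_prob]: for an MDP and a policy, the probability that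
    [ST] is first visited at time [n], with [SU] avoided before. *)
Definition hit_mass (pi : S -> A -> R) (n : nat) (s : S) : R :=
  \sum_(p : n.-tuple S | first_hit ST SU s p) path_prob M pi s p.

Lemma hit_mass0 (pi : S -> A -> R) (s : S) : hit_mass pi 0 s = (s \in ST)%:R.
Proof.
rewrite /hit_mass (eq_bigl (fun p => (s \in ST) && (p == [tuple]))); last first.
  by move=> p; rewrite tuple0 eqxx andbT /first_hit /= andbT.
by case: (s \in ST) => /=; rewrite ?big_pred1_eq// big_pred0.
Qed.

(** First-step analysis: a nonempty path splits into its first successor and the rest. From [ST] or
    [SU] no such path is a first hit, since its start already violates the avoidance condition. *)
Lemma hit_massS (pi : S -> A -> R) (n : nat) (s : S) :
  hit_mass pi n.+1 s =
  if s \in ST :|: SU then 0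
  else \sum_s' chain_step M pi s s' * hit_mass pi n s'.
Proof.
rewrite /hit_mass (reindex (fun z : S * n.-tuple S => cons_tuple z.1 z.2)) /=.
  rewrite (eq_bigl (fun z : S * n.-tuple S =>
      (s \notin ST :|: SU) && first_hit ST SU z.1 z.2)); last first.
    by move=> z; rewrite /first_hit /= andbCA.
  case: ifP => hs; first by rewrite big_pred0.
  rewrite -(pair_big_dep xpredT
    (fun s' (p : n.-tuple S) => first_hit ST SU s' p)
    (fun s' (p : n.-tuple S) => chain_step M pi s s' * path_prob M pi s' p)) /=.
  by apply: eq_bigr => s' _; rewrite big_distrr.
exists (fun p : n.+1.-tuple S => (thead p, behead_tuple p)) => [[x p] _ | p _].
  by congr pair; apply: val_inj.
by apply: val_inj; rewrite /= [in RHS](tuple_eta p).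
Qed.

Hypothesis hM : is_mdp M.
Variable pi : S -> A -> R.
Hypothesis hpi : is_policy M pi.

Lemma chain_step_ge0 (s s' : S) : 0 <= chain_step M pi s s'.
Proof.
apply: sumr_ge0 => a _; have [[pi0 _] piN] := hpi s.
have [av|nav] := boolP (a \in avail M s); last by rewrite piN ?mul0r.
by rewrite mulr_ge0//; have [t0 _] := hM.2 s a av.
Qed.

Lemma sum_chain_step (s : S) : \sum_s' chain_step M pi s s' = 1.
Proof.
have [[_ pi1] piN] := hpi s; rewrite exchange_big /= -pi1.
apply: eq_bigr => a _; rewrite -big_distrr /=.
have [av|nav] := boolP (a \in avail M s); last by rewrite piN ?mul0r.
by have [_ ->] := hM.2 s a av; rewrite mulr1.
Qed.

Lemma hit_mass_ge0 (n : nat) (s : S) : 0 <= hit_mass pi n s.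
Proof.
elim: n s => [|n IH] s; first by rewrite hit_mass0 ler0n.
rewrite hit_massS; case: ifP => // _.
by apply: sumr_ge0 => s' _; rewrite mulr_ge0 ?chain_step_ge0.
Qed.

(** Induction on the horizon, for all states at once. In [ST] or [SU] only the term at time 0 can be
    nonzero; elsewhere that term vanishes and the others form an average, over the successors, of
    sums with a shorter horizon. *)
Lemma sum_hit_mass_le1 (n : nat) (s : S) : \sum_(0 <= k < n) hit_mass pi k s <= 1.
Proof.
elim: n s => [|n IH] s; first by rewrite big_geq// ler01.
rewrite big_nat_recl// hit_mass0; under eq_bigr do rewrite hit_massS.
have [_|] := boolP (s \in ST :|: SU).
  by rewrite big1// addr0 lern1 leq_b1.
rewrite finset.inE negb_or => /andP[/negbTE-> _].
rewrite add0r exchange_big /= -(sum_chain_step s); apply: ler_sum => s' _.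
by rewrite -big_distrr /= ler_piMr ?chain_step_ge0.
Qed.

Lemma reach_avoid_prob_ge0 (s : S) : 0 <= reach_avoid_prob ST SU M pi s.
Proof.
by apply/fine_ge0/nneseries_ge0 => n _ _; rewrite lee_fin hit_mass_ge0.
Qed.

Lemma reach_avoid_prob_le1 (s : S) : reach_avoid_prob ST SU M pi s <= 1.
Proof.
have le1 : (\sum_(0 <= n <oo) (hit_mass pi n s)%:E <= 1)%E.
  apply: lime_le.
    by apply: is_cvg_nneseries => n _ _; rewrite lee_fin hit_mass_ge0.
  by apply: nearW => n; rewrite sumEFin lee_fin sum_hit_mass_le1.
(* [fine] is faithful only on finite values, so the series must be shown finite before its bound
   transfers to the reals. *)
have fin : (\sum_(0 <= n <oo) (hit_mass pi n s)%:E)%E \is a fin_num.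
  rewrite ge0_fin_numE; first exact: le_lt_trans le1 (ltry _).
  by apply: nneseries_ge0 => n _ _; rewrite lee_fin hit_mass_ge0.
by rewrite -lee_fin /reach_avoid_prob fineK.
Qed.

End ReachAvoid.

Section RobustValues.
Context (R : realType) (S A : finType) (ST SU : {set S}).
Context (M : model R S A) (MI : imodel R S A).
Hypothesis hin : in_imdp M MI.

Lemma Vrob_le_Vopt (pi0 : S -> A -> R) (s : S) :
  is_policy M pi0 -> Vrob ST SU MI s <= Vopt ST SU M s.
Proof.
have [hM hF _] := hin => hpi0.
(* [pi0] witnesses that the supremum is over a nonempty set. *)
apply: ge_sup; first by eexists; exists pi0; rewrite // -hF.
move=> _ [pi hpi <-].
have hpiM : is_policy M pi by rewrite hF.
apply: (@le_trans _ _ (reach_avoid_prob ST SU M pi s)).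
  apply: ge_inf; last by exists M.
  (* The bounds 0 here and 1 below make [inf] and [sup] genuine bounds of their sets. *)
  exists 0 => _ [M' [hM' hF' _] <-].
  by apply: reach_avoid_prob_ge0 => //; rewrite hF'.
apply: ub_le_sup; last by exists pi.
by exists 1 => _ [pi' hpi' <-]; apply: reach_avoid_prob_le1.
Qed.

Lemma Qrob_le_Qopt (pi0 : S -> A -> R) (s : S) (a : A) :
  is_policy M pi0 -> a \in avail M s -> Qrob ST SU MI s a <= Qopt ST SU M s a.
Proof.
have [hM hF ht] := hin => hpi0 av.
have dM := hM.2 s a av.
(* The middle term pairs the true row, which is admissible for the infimum, with the robust
   values. *)
apply: (@le_trans _ _ (\sum_s' trans M s a s' * Vrob ST SU MI s')).
  apply: ge_inf; last first.
    by exists (trans M s a) => //; split=> // s'; apply: ht; rewrite -hF.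
  (* A crude lower bound for the infimum, valid because every weight lies in [0, 1]. *)
  exists (- \sum_s' `|Vrob ST SU MI s'|) => _ [t [[t0 t1] _] <-].
  rewrite -sumrN; apply: ler_sum => s' _.
  have tle1 : t s' <= 1 by rewrite -t1 (bigD1 s')//= lerDl sumr_ge0.
  apply: le_trans (lerNnormlW (lexx _)); rewrite lerN2 normrM (ger0_norm (t0 s')).
  by rewrite ler_piMl.
by apply: ler_sum => s' _; rewrite ler_wpM2l ?dM.1//; exact: Vrob_le_Vopt hpi0.
Qed.

End RobustValues.

(** The argument covers any index that [xget] returns, its default 0 included. *)
Lemma spibb_outside (R : realType) (S A : finType) (F : frame R S A)
    (tb : S -> {set A} -> A) (Ash : S -> {set A}) (D : dataset S A) (Nw : nat)
    (pib : S -> A -> R) (s : S) (a : A) :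
  a \notin Ash s -> spibb F tb Ash D Nw pib s a = 0.
Proof.
move=> ha; rewrite /spibb /spibb_iter; case: (xget _ _) => [|n] /=.
  by rewrite /shielded (negbTE ha).
by rewrite /spibb_step /bootstrapped ha orbT /shielded (negbTE ha).
Qed.

(** There are countably many datasets, so the preimage is a countable union of fibres, each kept or
    emptied according to [E]. *)
Lemma measurable_random_dataset (d : measure_display) (Om : measurableType d)
    (S A : finType) (D : Om -> dataset S A) (E : set (dataset S A)) :
  random_dataset D -> measurable (D @^-1` E).
Proof.
move=> hD; rewrite (_ : D @^-1` E = \bigcup_x (D @^-1` [set x] `&` [set w | E x])).
  apply: countable_bigcupT_measurable => [|x].
    exact: (@countableP (seq (S * A * S)%type)).
  have [Ex|nEx] := pselect (E x).
    by rewrite (_ : [set w | E x] = setT) ?setIT//; apply/seteqP; split.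
  by rewrite (_ : [set w | E x] = set0) ?setI0//; apply/seteqP; split.
by apply/seteqP; split=> [w Ew|w [x _ [/= ->]]//]; exists (D w).
Qed.

Theorem lemma3 (R : realType) (S A : finType)
  (ST SU : {set S}) (hdisj : [disjoint ST & SU]%B)
  (Mstar : model R S A) (hMstar : is_mdp Mstar)
  (d : measure_display) (Om : measurableType d) (P : probability Om R)
  (D : Om -> dataset S A) (hD : collected_in P Mstar D)
  (deltaI : R) (hdeltaI : 0 <= deltaI <= 1)
  (MI : dataset S A -> imodel R S A)
  (hMI : forall D0, is_imdp (MI D0))
  (hframe : forall D0, imodel_frame (MI D0) = model_frame Mstar)
  (hcover : ((1 - deltaI)%:E <= P [set w | in_imdp Mstar (MI (D w))])%E)
  (theta : R) (htheta : 0 <= theta <= 1)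
  (hfeas : {ae P, forall w, feasible ST SU (MI (D w)) theta})
  (pib : S -> A -> R) (hpib : is_policy Mstar pib)
  (Nw : nat) (tb : S -> {set A} -> A) (htb : tie_break tb) :
  ((1 - deltaI)%:E <=
   P [set w | forall s a,
        a \in supp (spibb Mstar tb (shield ST SU (MI (D w)) theta)
                      (D w) Nw pib s) ->
        (1 - theta <= Qopt ST SU Mstar s a)%R])%E.
Proof.
have [mD _ _] := hD.
(* Both events depend on the dataset only, hence are measurable; it remains to prove the inclusion
   pointwise. *)
apply: (le_trans hcover); apply: le_measure.
- rewrite inE.
  exact: (measurable_random_dataset [set D0 | in_imdp Mstar (MI D0)] mD).
- rewrite inE; exact: (measurable_random_dataset [set D0 | forall s a,
    a \in supp (spibb Mstar tb (shield ST SU (MI D0) theta) D0 Nw pib s) ->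
    1 - theta <= Qopt ST SU Mstar s a] mD).
move=> w /= hin s a; rewrite finset.inE => spibb_gt0.
have : a \in shield ST SU (MI (D w)) theta s.
  by apply: contraTT spibb_gt0 => ha; rewrite spibb_outside ?ltxx.
rewrite finset.inE hframe => /andP[av /ltW ltQ].
exact: le_trans ltQ (Qrob_le_Qopt _ _ hin hpib av).
Qed.
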